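(* Let $T$ be a topological tree, $f\colon T\to T$ a continuous map, and $(C(T),\tilde f)$ the induced system on the hyperspace of subcontinua of $T$. Let $A\in C(T)$ be a periodic point of $\tilde f$ containing a point $z\in T$ such that $f(z)=z$. Then the period of $A$ (under $\tilde f$) is a divisor of $\operatorname{lcm}\{1,2,\dots,|\operatorname{End}(T)|\}$.
   Context: A topological graph is a continuum (compact connected metric space) homeomorphic to the geometric carrier of a (finite) one-dimensional simplicial complex; a topological tree is a topological graph containing no subset homeomorphic to the circle. $\operatorname{End}(T)$ is the set of endpoints of $T$, i.e. points of valence $1$ (points $x$ such that $U\setminus\{x\}$ is connected and nonempty for small connected neighborhoods $U$ of $x$). $C(T)$ is the set of all nonempty subcontinua of $T$ (including singletons) with the Hausdorff metric, and $\tilde f(A)=f(A)$. The period of a periodic point is its minimal period. *)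

(* Defs.v *)
From HB Require Import structures.
From mathcomp Require Import all_boot all_order all_algebra finmap.
From mathcomp Require Import all_classical all_reals all_analysis.
Set Implicit Arguments.
Unset Strict Implicit.
Unset Printing Implicit Defensive.
Import Order.TTheory GRing.Theory Num.Theory.
Import numFieldNormedType.Exports.
Local Open Scope classical_set_scope.
Local Open Scope ring_scope.

(* Homeomorphism of A and B for their subspace topologies; only the values of
   the total functions f on A and g on B matter. *)
Definition homeomorphic (X Y : topologicalType) (A : set X) (B : set Y) : Prop :=
  exists (f : X -> Y) (g : Y -> X),
    [/\ {within A, continuous f} /\ {within B, continuous g},
        f @` A `<=` B, g @` B `<=` A,
        {in A, cancel f g} & {in B, cancel g f}].

Definition simplicial_complex (n : nat) (K : {set {set 'I_n}}) : Prop :=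
  finset.set0 \notin K /\
  forall s t : {set 'I_n}, s \in K -> t \subset s -> t != finset.set0 ->
    t \in K.

(* A simplex with k vertices has dimension k - 1. *)
Definition one_dimensional (n : nat) (K : {set {set 'I_n}}) : Prop :=
  \max_(s in K) #|s| = 2%N.

(* Barycentric coordinates: the vertex i sits at the i-th basis vector. *)
Definition carrier (R : realType) (n : nat) (K : {set {set 'I_n}}) :
    set 'rV[R]_n :=
  [set x : 'rV[R]_n | [/\ forall i, 0 <= x 0 i, \sum_i x 0 i = 1 &
               [set i | x 0 i != 0]%SET \in K]].

Definition circle (R : realType) : set (R * R) :=
  [set p | p.1 ^+ 2 + p.2 ^+ 2 = 1].

Definition subcontinuum (T : topologicalType) (A : set T) : Prop :=
  [/\ A !=set0, compact A & connected A].

Definition topological_graph (R : realType) (T : metricType R) : Prop :=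
  subcontinuum [set: T] /\
  exists (n : nat) (K : {set {set 'I_n}}),
    [/\ simplicial_complex K, one_dimensional K &
        homeomorphic [set: T] (@carrier R n K)].

Definition topological_tree (R : realType) (T : metricType R) : Prop :=
  topological_graph T /\
  ~ exists A : set T, homeomorphic A (@circle R).

(* The library's [connected] holds of the empty set, so nonemptiness is
   required separately. *)
Definition endpoint (T : topologicalType) (x : T) : Prop :=
  exists2 V : set T, nbhs x V &
    forall U : set T, nbhs x U -> connected U -> U `<=` V ->
      U `\ x !=set0 /\ connected (U `\ x).

Definition End (T : topologicalType) : set T := [set x | endpoint x].

Definition hyperspace (T : topologicalType) : set (set T) :=
  [set A | subcontinuum A].

Definition induced_map (T : Type) (f : T -> T) (A : set T) : set T := f @` A.

Lemma induced_map_hyperspace (T : topologicalType) (f : T -> T) :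
  continuous f ->
  forall A : set T, hyperspace A -> hyperspace (induced_map f A).
Proof.
move=> fc A [[a Aa] Ac Aco]; split.
- by exists (f a); exists a.
- by apply: continuous_compact => //; exact: continuous_subspaceT.
- by apply: connected_continuous_connected => //; exact: continuous_subspaceT.
Qed.

Definition periodic_point (X : Type) (F : X -> X) (x : X) : Prop :=
  exists p : nat, (0 < p)%N /\ iter p F x = x.

Definition is_period (X : Type) (F : X -> X) (x : X) (p : nat) : Prop :=
  [/\ (0 < p)%N, iter p F x = x &
      forall q : nat, (0 < q)%N -> iter q F x = x -> (p <= q)%N].

(* Main.v *)
Require Import Defs.
From HB Require Import structures.
From mathcomp Require Import all_boot all_order all_algebra finmap.
From mathcomp Require Import all_classical all_reals all_analysis.
From mathcomp Require Import lra zify.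
Set Implicit Arguments.
Unset Strict Implicit.
Unset Printing Implicit Defensive.
Import Order.TTheory GRing.Theory Num.Theory.
Import numFieldNormedType.Exports.
Local Open Scope classical_set_scope.
Local Open Scope ring_scope.

(* Root the tree at the fixed point z and write [z, x] for the arc from z to x.
   Every A_i = f^i(A) contains z, hence is a union of arcs [z, x], and on the
   arc [z, e] to a leaf e it is determined by its top point a_(i,e). Since
   f(A_i) = A_(i+1), each a_(i+1,e) lies in the image of some arc [z, a_(i,e')],
   so tracing preimages yields infinite backward chains of top points, which
   recur by finiteness. Among consecutive terms of a chain, as many as there are
   leaves plus one, two lie on the same arc [z, e], at distance d at most the
   number of leaves, and are comparable. Comparability and recurrence give a
   point x of some A_i with x in f^m([z, x]) where m = d or m = -d modulo the
   period; then x lies in A_(i+kd) for all k, hence in A_(i+kL) for all k, L being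
   the lcm. This property propagates forward along the chain, so A_L = A.

   The order structure comes from a spanning tree of the complex: an edge off
   the tree would close up to a circle, so every edge is a cut edge, and the sum
   of the barycentric coordinates on one side of it is a cut function. *)

(** * Connectedness and compactness of real intervals *)

Lemma connected_ivt (R : realType) (T : topologicalType) (C : set T)
    (g : T -> R) (x y : T) (c : R) :
  connected C -> continuous g -> C x -> C y -> g x <= c <= g y ->
  exists2 w, C w & g w = c.
Proof.
move=> Cc gc Cx Cy xcy.
have /connected_intervalP iC : connected (g @` C).
  by apply: connected_continuous_connected => //; exact: continuous_subspaceT.
by have [] := iC (g x) (g y) (imageP g Cx) (imageP g Cy) c xcy; move=> w; exists w.
Qed.

Lemma connected_image_itv (R : realType) (T : topologicalType) (g : R -> T)
    (S : set R) :
  is_interval S -> continuous g -> connected (g @` S).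
Proof.
move=> iS gc; apply: connected_continuous_connected.
  exact/connected_intervalP.
exact: continuous_subspaceT.
Qed.

Lemma is_interval_cc (R : realType) (a b : R) :
  is_interval [set t | a <= t <= b].
Proof. by move=> x y /= ? ? z ?; lra. Qed.

Lemma is_interval_oo (R : realType) (a b : R) :
  is_interval [set t | a < t < b].
Proof. by move=> x y /= ? ? z ?; lra. Qed.

Lemma compact_cc (R : realType) (a b : R) : compact [set t | a <= t <= b].
Proof.
have -> : [set t | a <= t <= b] = `[a, b]%classic.
  by apply/seteqP; split=> t /=; rewrite in_itv.
exact: segment_compact.
Qed.

(** * Rooted trees *)

(* [x] lies on the arc from [z] to [y]. *)
Definition below (T : topologicalType) (z y x : T) : Prop :=
  forall C : set T, closed C -> connected C -> C z -> C y -> C x.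

Lemma below_refl (T : topologicalType) (z y : T) : below z y y.
Proof. by []. Qed.

Lemma below_trans (T : topologicalType) (z x y w : T) :
  below z y x -> below z w y -> below z w x.
Proof. by move=> yx wy C cC kC Cz Cw; apply: yx => //; exact: wy. Qed.

Lemma below_root (T : topologicalType) (z y : T) : below z y z.
Proof. by []. Qed.

(* [sg v] parametrizes an edge pointing away from the root [z], and [ct v] is
   the cut function of that edge: it is the parameter on the edge itself, and
   0 or 1 elsewhere according to the side of the edge. *)
Record rooted_tree (R : realType) (T : topologicalType) (z : T) (I : finType)
    (D : {set I}) (dep : I -> nat) (sg : I -> R -> T) (ct : I -> T -> R) :
    Prop := RootedTree {
  sg_continuous : forall v, v \in D -> continuous (sg v);
  ct_continuous : forall v, v \in D -> continuous (ct v);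
  ct_root : forall v, v \in D -> ct v z = 0;
  ct_sg : forall v t, v \in D -> 0 <= t <= 1 -> ct v (sg v t) = t;
  ct_other : forall u v, u \in D -> v \in D -> u != v ->
    (forall t, 0 <= t <= 1 -> ct v (sg u t) = 0) \/
    (forall t, 0 <= t <= 1 -> ct v (sg u t) = 1);
  sg_base : forall v, v \in D -> sg v 0 = z \/
    exists w, [/\ w \in D, (dep w < dep v)%N & sg v 0 = sg w 1];
  sg_cover : forall x, x = z \/
    exists v t, [/\ v \in D, 0 < t <= 1 & x = sg v t] }.

Section RootedTree.
Variables (R : realType) (T : metricType R) (z : T) (I : finType).
Variables (D : {set I}) (dep : I -> nat) (sg : I -> R -> T) (ct : I -> T -> R).
Hypothesis rt : rooted_tree z D dep sg ct.

(** At the root and on every other edge [ct v] takes only the values 0 and 1, so a value strictly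
    between them locates the point on the edge [v]. *)
Lemma cut_interior x v : v \in D -> 0 < ct v x < 1 ->
  x = sg v (ct v x).
Proof.
move=> vD; case: (sg_cover rt x) => [->|[u [t [uD t01 ->]]]].
  by rewrite (ct_root rt) // ltxx.
have t01' : 0 <= t <= 1 by lra.
have [->|uv] := eqVneq u v; first by rewrite (ct_sg rt).
by case: (ct_other rt uD vD uv) => ->//; rewrite ltxx ?andbF.
Qed.

Lemma closed_set1 (x : T) : closed [set x].
Proof. exact/accessible_closed_set1/hausdorff_accessible/metric_hausdorff. Qed.

Lemma below_rootE : below z z = [set z].
Proof.
apply/seteqP; split=> [x|x ->]; last exact: below_refl.
by apply => //; [exact: closed_set1|exact: connected1].
Qed.

(** A connected set through [z] and [sg v u] takes every value of [ct v] from 0 to [u], and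
    [cut_interior] identifies the points where the values inside [(0, 1)] are taken. *)
Lemma sg_below v (t u : R) : v \in D -> 0 <= t <= u -> u <= 1 ->
  below z (sg v u) (sg v t).
Proof.
move=> vD tu u1 C cC kC Cz Cu.
have pos s : 0 < s <= u -> C (sg v s).
  move=> s0u; have [->//|su] := eqVneq s u.
  have sI : ct v z <= s <= ct v (sg v u) by rewrite (ct_root rt) // (ct_sg rt) //; lra.
  have [w Cw ws] := connected_ivt kC (ct_continuous rt vD) Cz Cu sI.
  have s1 : s < u by rewrite lt_neqAle su; lra.
  by rewrite -ws -cut_interior // ws; lra.
have [t0|t0] := ltP 0 t; first by apply: pos; lra.
have {tu} [-> u0] : t = 0 /\ 0 <= u by split; lra.
have [{}u0|u0'] := ltP 0 u; last by have <- : u = 0 by lra.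
(* The cut value 0 does not identify the base [sg v 0], which is therefore reached as a limit of the
   points [sg v s] with [s > 0]. *)
rewrite (closure_id C).1 // => B /(sg_continuous rt vD) B0.
have near0 : \forall s \near (0:R)^'+, (B (sg v s)) /\ (0 < s <= u).
  near=> s; split; first by near: s; exact: cvg_at_right_filter B0.
  by apply/andP; split; near: s; [exact: nbhs_right_gt|exact: nbhs_right_le].
have [s [Bs su]] := @filter_ex _ _ (at_right_proper_filter _) _ near0.
by exists (sg v s); split => //; exact: pos.
Unshelve. all: by end_near.
Qed.

(** The union is itself closed, connected and joins [z] to [sg v t], so it contains the arc;
    [sg_below] gives the converse. The base is the root or the top of an edge of smaller depth,
    hence the induction. *)
Lemma below_sgE v (t : R) : v \in D -> 0 <= t <= 1 ->
  below z (sg v t) = below z (sg v 0) `|` (sg v @` [set s | 0 <= s <= t])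
  /\ closed (below z (sg v t)) /\ connected (below z (sg v t)).
Proof.
have [n] := ubnP (dep v); elim: n v t => // n IH v t /ltnSE dv vD t01.
have [cB kB] : closed (below z (sg v 0)) /\ connected (below z (sg v 0)).
  case: (sg_base rt vD) => [->|[w [wD wv ->]]]; last first.
    have i01 : 0 <= (1 : R) <= 1 by rewrite ler01 lexx.
    by have [_] := IH w 1 (leq_trans wv dv) wD i01.
  by rewrite below_rootE; split; [exact: closed_set1|exact: connected1].
set S := _ `|` _.
have cS : closed S.
  apply: closedU => //; apply: compact_closed; first exact: metric_hausdorff.
  apply: continuous_compact; last exact: compact_cc.
  by apply: continuous_subspaceT; exact: (sg_continuous rt vD).
have kS : connected S.
  apply: connectedU => //.
    exists (sg v 0); split; first exact: below_refl.
    by exists 0 => //=; lra.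
  by apply: connected_image_itv; [exact: is_interval_cc|exact: (sg_continuous rt vD)].
suff -> : below z (sg v t) = S by [].
apply/seteqP; split.
  move=> x; apply=> //; first by left; exact: below_root.
  by right; exists t => //=; lra.
move=> x [xB|[s /= s01 <-]].
  by apply: below_trans xB _; apply: sg_below => //; lra.
by apply: sg_below => //; lra.
Qed.

Lemma below_closed_connected y : closed (below z y) /\ connected (below z y).
Proof.
case: (sg_cover rt y) => [->|[v [t [vD t01 ->]]]]; last first.
  have i01 : 0 <= t <= 1 by lra.
  by have [_] := below_sgE vD i01.
by rewrite below_rootE; split; [exact: closed_set1|exact: connected1].
Qed.

(** On one edge the parameter orders the points, and every point up to the base precedes the whole
    edge. *)
Lemma below_total_sg v (t : R) a b : v \in D -> 0 <= t <= 1 ->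
  below z (sg v t) a -> below z (sg v t) b -> below z a b \/ below z b a.
Proof.
have [n] := ubnP (dep v); elim: n v t a b => // n IH v t a b /ltnSE dv vD t01.
have IH0 a' b' : below z (sg v 0) a' -> below z (sg v 0) b' ->
    below z a' b' \/ below z b' a'.
  case: (sg_base rt vD) => [->|[w [wD wv ->]]].
    by rewrite below_rootE => -> ->; left; exact: below_refl.
  by apply: IH => //; [exact: leq_trans dv|rewrite ler01 lexx].
have [-> _] := below_sgE vD t01.
have up x s : below z (sg v 0) x -> 0 <= s <= 1 -> below z (sg v s) x.
  by move=> x0 s01; apply: below_trans x0 _; apply: sg_below => //; lra.
move=> [a0|[s /= s01 <-]] [b0|[r /= r01 <-]].
- exact: IH0.
- by right; apply: up => //; lra.
- by left; apply: up => //; lra.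
- by have [sr|rs] := leP s r; [right|left]; apply: sg_below => //; lra.
Qed.

(** Search from the last edge towards the root: on the first edge that [A] meets, compactness gives
    a largest parameter. The search succeeds because [A] contains the root. *)
Lemma below_max v (A : set T) : v \in D -> closed A -> A z ->
  exists a, [/\ A a, below z (sg v 1) a &
    forall b, A b -> below z (sg v 1) b -> below z a b].
Proof.
move=> + cA Az; have [n] := ubnP (dep v).
elim: n v => // n IH v /ltnSE dv vD.
have i01 : 0 <= (1 : R) <= 1 by rewrite ler01 lexx.
have [E1 _] := below_sgE vD i01.
have [[t At]|noA] := pselect (exists t, [set s | 0 <= s <= 1 /\ A (sg v s)] t).
  have cS : compact [set s | 0 <= s <= 1 /\ A (sg v s)].
    have -> : [set s | 0 <= s <= 1 /\ A (sg v s)] =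
        [set s | 0 <= s <= 1] `&` sg v @^-1` A by [].
    apply: compact_closedI; first exact: compact_cc.
    by move/continuous_closedP: (sg_continuous rt vD); exact.
  have [] := @compact_EVT_max _ R id _ _ cS.
  - by exists t.
  - by apply: continuous_subspaceT => x; exact: cvg_id.
  move=> c /set_mem[c01 Ac] cmax; exists (sg v c); split => //.
    by apply: sg_below => //; lra.
  move=> b Ab; rewrite E1 => -[b0|[s /= s01 bE]].
    by apply: below_trans b0 _; apply: sg_below => //; lra.
  rewrite -bE; apply: sg_below => //; last by lra.
  apply/andP; split; first lra.
  by apply: cmax; rewrite inE; split=> //; rewrite bE.
case: (sg_base rt vD) => [v0|[w [wD wv v0]]].
  by case: noA; exists 0; split; [rewrite lexx ler01|rewrite v0].
have [a [Aa aw amax]] := IH w (leq_trans wv dv) wD.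
exists a; split=> //.
  by rewrite E1; left; rewrite v0.
move=> b Ab; rewrite E1 v0 => -[|[s /= s01 bE]]; first exact: amax.
by case: noA; exists s; split=> //; rewrite bE.
Qed.

(** If [u] is not [v], the value 1 persists at the base of [u], which is the top of a shallower
    edge. The value at the root being 0, the descent must meet [v]. *)
Lemma cut1_below u v : u \in D -> v \in D -> ct v (sg u 1) = 1 ->
  u = v \/ (dep v < dep u)%N /\ below z (sg u 1) (sg v 1).
Proof.
have [n] := ubnP (dep u); elim: n u => // n IH u /ltnSE du uD vD c1.
have [|uv] := eqVneq u v; first by left.
have i01 : 0 <= (1 : R) <= 1 by rewrite ler01 lexx.
have i00 : 0 <= (0 : R) <= 1 by rewrite ler01 lexx.
have c0 : ct v (sg u 0) = 1.
  case: (ct_other rt uD vD uv) => c; last exact: c.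
  by move: c1; rewrite c // => /esym/eqP; rewrite oner_eq0.
have u01 : below z (sg u 1) (sg u 0) by apply: sg_below => //; lra.
case: (sg_base rt uD) => [u0|[w [wD wu u0]]].
  by move: c0; rewrite u0 (ct_root rt) // => /esym/eqP; rewrite oner_eq0.
rewrite u0 in c0 u01; right.
case: (IH w (leq_trans wu du) wD vD c0) => [<-//|[vw wv]].
by split; [exact: ltn_trans wu|exact: below_trans u01].
Qed.

(** The edges with nothing beyond them. Testing one point per edge suffices, as [ct v] is constant
    on every edge other than [v]. *)
Definition leaves : {set I} :=
  [set v in D | [forall u in D, (u != v) ==> (ct v (sg u 1) == 0)]]%SET.

Lemma leafP v : v \in leaves -> v \in D /\
  forall u t, u \in D -> u != v -> 0 <= t <= 1 -> ct v (sg u t) = 0.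
Proof.
rewrite inE => /andP[vD /forall_inP lv]; split=> // u t uD uv.
have /implyP/(_ uv)/eqP c1 := lv u uD.
case: (ct_other rt uD vD uv) => c; first exact: c.
have i01 : 0 <= (1 : R) <= 1 by rewrite ler01 lexx.
by move: c1; rewrite c // => /eqP; rewrite oner_eq0.
Qed.

(** Among the edges whose arc from the root passes through [x], one of maximal depth is a leaf: by
    [cut1_below], an edge beyond it would be a deeper candidate. *)
Lemma leaf_cover x : x = z \/ exists2 v, v \in leaves & below z (sg v 1) x.
Proof.
case: (sg_cover rt x) => [|[v [t [vD t01 xE]]]]; first by left.
right; pose P u := (u \in D) && `[< below z (sg u 1) x >].
have Pv : P v.
  by rewrite /P vD; apply/asboolP; rewrite xE; apply: sg_below => //; lra.
case: (arg_maxnP dep Pv) => w /andP[wD /asboolP wx] wmax; exists w => //.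
rewrite inE wD; apply/forall_inP => u uD; apply/implyP => uw.
have i01 : 0 <= (1 : R) <= 1 by rewrite ler01 lexx.
case: (ct_other rt uD wD uw) => c; first by rewrite c.
case: (cut1_below uD wD (c _ i01)) => [ww|[wu uwb]].
  by rewrite ww eqxx in uw.
have : P u by rewrite /P uD; apply/asboolP; exact: below_trans wx uwb.
by move/wmax => /=; rewrite leqNgt wu.
Qed.

(** The neighbourhood [ct v > 0] of the top is a half-open edge, and an interval stays an interval
    when its end is removed. *)
Lemma leaf_endpoint v : v \in leaves -> endpoint (sg v 1).
Proof.
move=> /leafP[vD lv].
have i01 : 0 <= (1 : R) <= 1 by rewrite ler01 lexx.
have inV x : 0 < ct v x -> x = sg v (ct v x) /\ 0 < ct v x <= 1.
  case: (sg_cover rt x) => [->|[u [t [uD t01 ->]]]].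
    by rewrite (ct_root rt) // ltxx.
  have t01' : 0 <= t <= 1 by lra.
  have [->|uv] := eqVneq u v; first by rewrite (ct_sg rt).
  by rewrite lv // ltxx.
exists [set x | 0 < ct v x].
  apply: open_nbhs_nbhs; split; last by rewrite /= (ct_sg rt) // ltr01.
  have /continuousP cv := ct_continuous rt vD.
  by apply: (cv [set t | 0 < t]); exact: open_gt.
move=> U U1 kU UV; split.
  have near1 : \forall s \near (1:R)^'-, U (sg v s) /\ 0 < s < 1.
    have B1 := sg_continuous rt vD U1.
    near=> s; split; first by near: s; exact: cvg_at_left_filter B1.
    by apply/andP; split; near: s; [apply: nbhs_left_gt; exact: ltr01|exact: nbhs_left_lt].
  have [s [Us s1]] := @filter_ex _ _ (at_left_proper_filter _) _ near1.
  exists (sg v s); split => //= /(congr1 (ct v)).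
  by rewrite !(ct_sg rt) //; lra.
have -> : U `\ sg v 1 = sg v @` [set t | 0 < t < 1 /\ U (sg v t)].
  apply/seteqP; split => [x [Ux xv]|_ [t [t01 Ut] <-]].
    have [xE x01] := inV _ (UV _ Ux).
    have c1 : ct v x < 1.
      rewrite lt_neqAle; case/andP: x01 => _ ->; rewrite andbT.
      by apply/eqP => c1; apply: xv; rewrite /= xE c1.
    by exists (ct v x) => //; split; [lra|rewrite -xE].
  split=> //= /(congr1 (ct v)); rewrite !(ct_sg rt) //; lra.
apply: connected_image_itv; last exact: (sg_continuous rt vD).
move=> a b [a01 Ua] [b01 Ub] c acb; split; first by move: a01 b01 => /=; lra.
have cacb : ct v (sg v a) <= c <= ct v (sg v b) by rewrite !(ct_sg rt) //; lra.
have [w Uw wc] := connected_ivt kU (ct_continuous rt vD) Ua Ub cacb.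
by have [wE _] := inV _ (UV _ Uw); rewrite -wc -wE.
Unshelve. all: by end_near.
Qed.

(** On a small arc around the point, [ct v] takes the value [t] only at the point itself, so
    removing it separates the two sides. *)
Lemma interior_not_endpoint v t : v \in D -> 0 < t < 1 ->
  ~ endpoint (sg v t).
Proof.
move=> vD t01 [V nV]; apply/existsNP.
have := sg_continuous rt vD nV.
move=> /nbhs_ballP[e /= e0 eV].
(* Radius for which the arc stays inside the edge and inside [V]. *)
pose d := Num.min e (Num.min t (1 - t)).
have d0 : 0 < d by rewrite /d !lt_min e0; lra.
have [de [dt dt1]] : d <= e /\ d <= t /\ d <= 1 - t.
  by rewrite /d !ge_min !lexx ?orbT.
pose S := [set s | t - d < s < t + d].
have S01 s : S s -> 0 <= s <= 1 by rewrite /S /=; lra.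
exists (sg v @` S) => UH.
have nU : nbhs (sg v t) (sg v @` S).
  have : nbhs (sg v t) (ct v @^-1` S).
    apply: (ct_continuous rt vD); rewrite (ct_sg rt) //; last by lra.
    apply/nbhs_ballP; exists d => //= s; rewrite /ball /= /S /=.
    by rewrite ltr_norml; lra.
  apply: filterS => x Sx; exists (ct v x) => //.
  by rewrite -cut_interior //; move: Sx; rewrite /S /=; lra.
have kU : connected (sg v @` S).
  by apply: connected_image_itv; [exact: is_interval_oo|exact: (sg_continuous rt vD)].
have UV : sg v @` S `<=` V.
  move=> _ [s Ss <-]; apply: eV; rewrite /ball /= ltr_norml.
  by move: Ss; rewrite /S /=; lra.
have [_ kUt] := UH nU kU UV.
have Ud s : s = t - d / 2 \/ s = t + d / 2 -> (sg v @` S `\ sg v t) (sg v s).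
  move=> sE; have Ss : S s by rewrite /S /=; case: sE => ->; lra.
  split; first by exists s.
  have [s01 t01'] : 0 <= s <= 1 /\ 0 <= t <= 1 by split; [exact: S01|lra].
  by move=> /(congr1 (ct v)); rewrite !(ct_sg rt) //; case: sE => ->; lra.
have c12 : ct v (sg v (t - d / 2)) <= t <= ct v (sg v (t + d / 2)).
  by rewrite !(ct_sg rt) //; lra.
have [w [_ wt] cw] := connected_ivt kUt (ct_continuous rt vD)
  (Ud _ (or_introl erefl)) (Ud _ (or_intror erefl)) c12.
by apply: wt => /=; have := @cut_interior w v vD; rewrite cw; apply.
Qed.

(** Only the root and the tops of the finitely many edges can be endpoints. Finiteness matters
    because [fset_set] is empty by default on infinite sets. *)
Lemma End_finite : finite_set (End (T := T)).
Proof.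
apply: (@sub_finite_set _ _ (z |` ((fun v => sg v 1) @` [set` D]))).
  move=> x xE; case: (sg_cover rt x) => [->|[v [t [vD t01 xv]]]]; first by left.
  right; exists v => //; rewrite xv; have [->//|t1] := eqVneq t 1.
  case: (@interior_not_endpoint v t) => //; last by rewrite -xv.
  by have t1' : t < 1; [rewrite lt_neqAle t1; lra|lra].
by rewrite finite_setU; split; [exact: finite_set1|exact/finite_image/finite_finset].
Qed.

(** The tops of leaves are endpoints, told apart by the cut functions. Equality can fail, as the
    root may be an endpoint too. *)
Lemma card_leaves : (#|leaves| <= #|` fset_set (End (T := T))|)%N.
Proof.
rewrite cardE -(size_map (fun v => sg v 1)); apply: uniq_leq_size.
  rewrite map_inj_in_uniq ?enum_uniq // => u v; rewrite !mem_enum.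
  move=> /leafP[uD _] /leafP[vD lv] uv; apply/eqP/negPn/negP => uNv.
  have i01 : 0 <= (1 : R) <= 1 by rewrite ler01 lexx.
  have := lv u 1 uD uNv i01; rewrite uv (ct_sg rt) // => /eqP.
  by rewrite oner_eq0.
move=> x /mapP[v]; rewrite mem_enum => vl ->.
rewrite in_fset_set ?inE; first exact: leaf_endpoint.
exact: End_finite.
Qed.

End RootedTree.

(** * Periods of subcontinua containing the root *)

Lemma dvdn_biglcm_nat (d e : nat) : (0 < d <= e)%N ->
  (d %| \big[lcmn/1]_(1 <= k < e.+1) k)%N.
Proof.
elim: e => [|e IH]; first by case: d.
move=> /andP[d0]; rewrite leq_eqVlt big_nat_recr //= => /predU1P[->|de].
  exact: dvdn_lcmr.
by apply: dvdn_trans (dvdn_lcml _ _); apply: IH; rewrite d0.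
Qed.

Lemma biglcm_nat_dvdn (e e' : nat) : (e <= e')%N ->
  (\big[lcmn/1]_(1 <= k < e.+1) k %| \big[lcmn/1]_(1 <= k < e'.+1) k)%N.
Proof.
elim: e => [|e IH] ee'; first by rewrite big_nil dvd1n.
by rewrite big_nat_recr //= dvdn_lcm IH ?dvdn_biglcm_nat // ltnW.
Qed.

Lemma pigeonhole_nat (I : finType) (J : {set I}) (g : nat -> I) :
  (forall k, g k \in J) ->
  exists k k', [/\ (k < k')%N, (k' <= #|J|)%N & g k = g k'].
Proof.
move=> gJ; have : ~~ uniq (mkseq g #|J|.+1).
  apply/negP => U; have := @uniq_leq_size _ _ (enum J) U.
  rewrite size_mkseq -cardE ltnn => /(_ _)/negP; apply => // x.
  by move=> /mapP[k _ ->]; rewrite mem_enum.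
move=> /(uniqPn (g 0%N)) [k [k' []]]; rewrite size_mkseq => kk' k'J.
rewrite !nth_mkseq //; last exact: ltn_trans k'J.
by exists k, k'.
Qed.

Lemma is_period_dvdn (X : Type) (F : X -> X) (x : X) (p n : nat) :
  is_period F x p -> iter n F x = x -> (p %| n)%N.
Proof.
move=> [p0 px pmin] nx; rewrite /dvdn -leqn0 leqNgt; apply/negP => m0.
have kx k : iter (k * p) F x = x.
  by elim: k => // k IH; rewrite mulSn iterD IH.
have := pmin _ m0; rewrite leqNgt ltn_mod p0 => /(_ _)/negP; apply => //.
by move: nx; rewrite {1}(divn_eq n p) addnC iterD kx.
Qed.

Section Dynamics.
Variables (R : realType) (T : metricType R) (z : T) (I : finType).
Variables (D : {set I}) (dep : I -> nat) (sg : I -> R -> T) (ct : I -> T -> R).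
Hypothesis rt : rooted_tree z D dep sg ct.
Variables (f : T -> T).
Hypotheses (cT : compact [set: T]) (fc : continuous f) (fz : f z = z).

Definition covers (n : nat) (x y : T) : Prop :=
  exists2 b, below z x b & iter n f b = y.

Lemma iter_continuous n : continuous (iter n f).
Proof.
elim: n => [|n IH] x; first exact: cvg_id.
by apply: continuous_comp; [exact: IH|exact: fc].
Qed.

Lemma iter_root n : iter n f z = z.
Proof. by elim: n => //= n ->. Qed.

Lemma image_closed_connected (g : T -> T) (C : set T) : continuous g ->
  closed C /\ connected C -> closed (g @` C) /\ connected (g @` C).
Proof.
move=> gc [cC kC]; split; last first.
  by apply: connected_continuous_connected => //; exact: continuous_subspaceT.
apply: compact_closed; first exact: metric_hausdorff.
apply: continuous_compact; first exact: continuous_subspaceT.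
exact: (subclosed_compact cC cT).
Qed.

(** The image of the arc from [z] to [x] is closed (by compactness), connected, and contains [z] and
    [y], hence the whole arc between them. *)
Lemma covers_below n x y w : covers n x y -> below z y w -> covers n x w.
Proof.
move=> xy yw; suff [b xb <-] : (iter n f @` below z x) w by exists b.
have [cB kB] := image_closed_connected (@iter_continuous n)
  (below_closed_connected rt x).
by apply: yw => //; exists z; [exact: below_root|exact: iter_root].
Qed.

Lemma covers_trans m n x y w :
  covers n x y -> covers m y w -> covers (m + n) x w.
Proof.
move=> xy [c yc <-]; have [b xb <-] := covers_below xy yc.
by exists b; rewrite ?iterD.
Qed.

Variable A : set T.
Hypotheses (cA : closed A) (kA : connected A) (Az : A z).
Variable p : nat.
Hypothesis pA : is_period (induced_map f) A p.

Let orb i := iter i (induced_map f) A.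

Lemma orb_closed_connected i : closed (orb i) /\ connected (orb i).
Proof. by elim: i => //= i IH; exact: image_closed_connected. Qed.

Lemma orb_root i : orb i z.
Proof. by elim: i => //= i IH; exists z. Qed.

Lemma orb_below i x y : orb i x -> below z x y -> orb i y.
Proof.
by have [? ?] := orb_closed_connected i; move=> ? yx; apply: yx => //; exact: orb_root.
Qed.

Lemma orb_iter n i x : orb i x -> orb (n + i) (iter n f x).
Proof.
move=> ix; elim: n => // n IH; rewrite addSn iterS.
by exists (iter n f x).
Qed.

Lemma orb_period i k : orb (i + k * p) = orb i.
Proof.
rewrite /orb iterD; congr (iter _ _ _); elim: k => // k IH.
by rewrite mulSn iterD IH; case: pA.
Qed.

(** [orb i] contains the arc from [z] to [x], and the image of that arc after [m] steps contains [x]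
    again; iterate. *)
Lemma orb_loop m i x k : covers m x x -> orb i x -> orb (i + k * m) x.
Proof.
move=> [b xb bx] ix; elim: k => [|k IH]; first by rewrite addn0.
rewrite mulSn addnCA -bx; apply: orb_iter; exact: orb_below xb.
Qed.

Let L := \big[lcmn/1]_(1 <= k < #|leaves D sg ct|.+1) k.

(** Turns out to be all of [orb i] ([orb_core]), which makes [L] a return time of [A]. *)
Let core i x := forall k, orb (i + k * L) x.

Lemma core_covers n i x y : core i x -> covers n x y -> core (n + i) y.
Proof.
move=> ix [b xb <-] k; rewrite -addnA; apply: orb_iter.
exact: orb_below (ix k) xb.
Qed.

(* Of the comparable points [x (u + n)] and [x (u' + n)], with [u < u'], if the
   second is the lower one it covers itself after [u' - u] steps; otherwise the
   recurrent point [x (n + N' * p)] does after [N' * p - (u' - u)] steps. *)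
Lemma backward_loop (x : nat -> T) (j : nat -> I) (idx : nat -> nat) :
  (forall n, j n \in leaves D sg ct) ->
  (forall n, orb (idx n) (x n)) ->
  (forall n, below z (sg (j n) 1) (x n)) ->
  (forall n, covers 1 (x n.+1) (x n)) ->
  (forall n k, j n = j (n + k * p)%N -> x n = x (n + k * p)%N) ->
  exists n, core (idx n) (x n).
Proof.
move=> jl ox bx cx per.
have cxn n m : covers m (x (m + n)%N) (x n).
  elim: m => [|m IH]; first by exists (x n) => //; exact: below_refl.
  by rewrite addSn -[m.+1]addn1; exact: covers_trans (cx _) IH.
have p0 : (0 < p)%N by case: pA.
set e := #|leaves D sg ct|.
(* Sampling at multiples of [e.+1 * p] yields a return time [N' * p] of the chain that is at least
   [e], so that the window of [e.+1] terms used below fits into it. *)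
have [k [k' [kk' _ jkk']]] := pigeonhole_nat (fun k => jl (k * (e.+1 * p))%N).
pose n := (k * (e.+1 * p))%N; pose N' := ((k' - k) * e.+1)%N.
have nN : (k' * (e.+1 * p) = n + N' * p)%N.
  by rewrite /n /N' -mulnA -mulnDl subnKC // ltnW.
rewrite nN -/n in jkk'.
have eN : (e <= N' * p)%N.
  have d0 : (0 < k' - k)%N by rewrite subn_gt0.
  by rewrite /N'; nia.
(* Two of [e.+1] successive terms lie under the same leaf; their distance is at most [e] and so
   divides [L]. *)
have [u [u' [uu' u'e juu']]] := pigeonhole_nat (fun u => jl (u + n)%N).
rewrite -/e in u'e.
have [q Lq] : exists q, L = (q * (u' - u))%N.
  by apply/dvdnP; apply: dvdn_biglcm_nat; rewrite subn_gt0 uu' (leq_trans (leq_subr _ _)).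
have uD := (leafP rt (jl (u + n)%N)).1.
have i01 : 0 <= (1 : R) <= 1 by rewrite ler01 lexx.
have bu := bx (u' + n)%N; rewrite -juu' in bu.
case: (below_total_sg rt uD i01 (bx _) bu) => [uu|u'u]; last first.
  exists (n + N' * p)%N => l.
  have c1 : covers (N' * p - u') (x (n + N' * p)%N) (x (u + n)%N).
    apply: covers_below u'u.
    by have := cxn (u' + n)%N (N' * p - u')%N; congr (covers _ (x _) _); lia.
  have := covers_trans c1 (cxn n u); rewrite (per _ _ jkk') => c2.
  (* The loop length is [-(u' - u)] modulo [p] and [p.-1] is -1, so [p.-1 * l * q] rounds amount to
     [l * L] modulo [p]; the other terms are multiples of [p]. *)
  have E : ((p.-1 * l * q) * (u + (N' * p - u')) + l * L * p =
      l * L + p.-1 * l * q * N' * p)%N.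
    rewrite Lq -(mulnA _ N' p).
    have [M NM] : exists M, (N' * p = M + (u' - u))%N.
      by exists (N' * p - (u' - u))%N; lia.
    have -> : (u + (N' * p - u') = M)%N by lia.
    by rewrite NM; case: (p) p0 => // p' _ /=; lia.
  have := orb_loop (p.-1 * l * q) c2 (ox _).
  by rewrite -(orb_period _ (l * L)) -addnA E addnA orb_period.
exists (u' + n)%N => l.
have c1 : covers (u' - u) (x (u' + n)%N) (x (u' + n)%N).
  apply: covers_below uu.
  by have := cxn (u + n)%N (u' - u)%N; congr (covers _ (x _) _); lia.
by have := orb_loop (l * q) c1 (ox _); rewrite Lq mulnA.
Qed.

(** A backward chain of top points, started on an arc through [x], has a term in the core by
    [backward_loop]. Covering carries this forward to the first top point, and [x] lies below it. *)
Lemma orb_core i x : orb i x -> core i x.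
Proof.
move=> ix; case: (leaf_cover rt x) => [->|[v0 v0l v0x]].
  by move=> k; exact: orb_root.
have p0 : (0 < p)%N by case: pA.
have : forall w : nat * I, exists a, w.2 \in leaves D sg ct ->
    [/\ orb w.1 a, below z (sg w.2 1) a &
     forall b, orb w.1 b -> below z (sg w.2 1) b -> below z a b].
  move=> [k v] /=; have [vl|] := boolP (v \in leaves D sg ct); last by exists z.
  have [a aP] := below_max rt (leafP rt vl).1 (orb_closed_connected k).1 (orb_root k).
  by exists a.
(* Reducing the index modulo [p] makes the choice of top points periodic, as [backward_loop]
   requires. *)
move=> /choice[top0 top0P]; pose top k v := top0 (k %% p, v)%N.
have orb_mod k : orb (k %% p)%N = orb k.
  by rewrite [in RHS](divn_eq k p) addnC orb_period.
have topP k v : v \in leaves D sg ct -> [/\ orb k (top k v),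
    below z (sg v 1) (top k v) &
    forall b, orb k b -> below z (sg v 1) b -> below z (top k v) b].
  by move=> vl; have := top0P (k %% p, v)%N vl; rewrite /= orb_mod.
(* Modulo [p], moving forward by [p.-1] is moving back by one: [idx n] stands for [i - n]. *)
pose idx n := (i + n * p.-1)%N.
have idxS n : ((idx n.+1).+1 = idx n + 1 * p)%N.
  by rewrite /idx mulSn; lia.
(* A top point has a preimage in the preceding subcontinuum; the preimage lies on the arc to some
   leaf, hence below the top point there. If the preimage is the root, any leaf will do. *)
have : forall w : nat * I, exists u, w.2 \in leaves D sg ct ->
    u \in leaves D sg ct /\ covers 1 (top (idx w.1.+1) u) (top (idx w.1) w.2).
  move=> [n v] /=; have [vl|] := boolP (v \in leaves D sg ct); last by exists v.
  have [+ _ _] := topP (idx n) v vl; rewrite -(orb_period _ 1) -idxS.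
  move=> [b bo bE]; case: (leaf_cover rt b) => [bz|[u ul ub]].
    exists v => _; split=> //; exists z; first exact: below_root.
    by rewrite /= -bE bz.
  exists u => _; split=> //; exists b => //.
  by have [_ _] := topP (idx n.+1) u ul; apply.
move=> /choice[nxt nxtP].
pose j := fix j n := if n is m.+1 then nxt (m, j m) else v0.
have jl n : j n \in leaves D sg ct.
  by elim: n => //= n /(nxtP (n, j n))[].
have [||||n] := @backward_loop (fun n => top (idx n) (j n)) j idx jl.
- by move=> n; have [] := topP (idx n) _ (jl n).
- by move=> n; have [] := topP (idx n) _ (jl n).
- by move=> n; have [] := nxtP (n, j n) (jl n).
- move=> n k <-; rewrite /top; congr (top0 (_, _)).
  have -> : (idx (n + k * p) = k * p.-1 * p + idx n)%N by rewrite /idx; lia.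
  by rewrite modnMDl.
move=> nc.
have : covers n (top (idx n) (j n)) (top (idx 0) v0).
  elim: (n) => [|m IH]; first by exists (top (idx 0) v0) => //; exact: below_refl.
  have [_ c1] := nxtP (m, j m) (jl m).
  by have := covers_trans c1 IH; rewrite addn1.
move=> /(core_covers nc) c0 k; have := c0 k.
have -> : (n + idx n + k * L = i + k * L + n * p)%N.
  by rewrite /idx; case: (p) p0 => // p' _ /=; lia.
rewrite orb_period => o0.
have [_ _ mx] := topP i _ v0l.
have : below z (top i v0) x by exact: mx.
by apply: orb_below; move: o0; rewrite /idx mul0n addn0.
Qed.

Lemma rooted_tree_period :
  (p %| \big[lcmn/1]_(1 <= k < #|leaves D sg ct|.+1) k)%N.
Proof.
apply: (is_period_dvdn pA); apply/seteqP; split=> x.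
  (* With [k = p.-1] the total shift is [L * p], a multiple of the period. *)
  move=> /orb_core/(_ p.-1); rewrite -/L.
  have p0 : (0 < p)%N by case: pA.
  have -> : (L + p.-1 * L = 0 + L * p)%N by case: (p) p0 => // p' _ /=; lia.
  by rewrite orb_period.
by move=> /(@orb_core 0)/(_ 1%N); rewrite mul1n add0n.
Qed.

End Dynamics.

(** * From simplicial complexes to rooted trees *)

(** The upper half of the circle is sent to [al] and the lower half to [be], both through the first
    coordinate. *)
Lemma two_arcs_circle (R : realType) (T : metricType R) (al be : R -> T) :
  continuous al -> continuous be ->
  (forall s t, -1 <= s <= 1 -> -1 <= t <= 1 -> al s = al t -> s = t) ->
  (forall s t, -1 <= s <= 1 -> -1 <= t <= 1 -> be s = be t -> s = t) ->
  al (-1) = be (-1) -> al 1 = be 1 ->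
  (forall s t, -1 <= s <= 1 -> -1 <= t <= 1 -> al s = be t ->
    t = -1 \/ t = 1) ->
  exists A : set T, homeomorphic A (@circle R).
Proof.
move=> alc bec ali bei ab0 ab1 abd.
have c1 (p : R * R) : circle p -> -1 <= p.1 <= 1.
  by case: p => x y; rewrite /circle /= => ?; nra.
have c20 (p : R * R) : circle p -> p.2 = 0 -> al p.1 = be p.1.
  case: p => x y; rewrite /circle /= => + y0; rewrite y0 expr0n addr0 => /eqP.
  by rewrite sqrf_eq1 => /orP[]/eqP ->.
clear ab0 ab1; pose h (p : R * R) := if 0 <= p.2 then al p.1 else be p.1.
have hi p q : circle p -> circle q -> h p = h q -> p = q.
  have mixed (p' q' : R * R) : circle p' -> circle q' -> 0 <= p'.2 -> q'.2 < 0 ->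
      al p'.1 <> be q'.1.
    move=> cp cq _ q0 /abd[||q1|q1]; [exact: c1|exact: c1| |];
    by move: cq q0; rewrite /circle /= q1 => ? ?; nra.
  move=> cp cq; have := mixed _ _ cp cq; have := mixed _ _ cq cp.
  have := ali _ _ (c1 _ cp) (c1 _ cq); have := bei _ _ (c1 _ cp) (c1 _ cq).
  move: cp cq; rewrite /h /circle; case: p => x y; case: q => x' y' /=.
  move=> cp cq beI alI m1 m2; have [y0|y0] := leP 0 y; have [y'0|y'0] := leP 0 y'.
  - by move=> /alI xx; rewrite -xx in cq *; congr (_, _); nra.
  - by move=> /m2; case.
  - by move=> e; case: m1.
  - by move=> /beI xx; rewrite -xx in cq *; congr (_, _); nra.
(* The inverse of [h], with an arbitrary value off its image. *)
have : forall a, exists p, (h @` @circle R) a -> circle p /\ h p = a.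
  move=> a; have [[p cp pa]|na] := pselect ((h @` @circle R) a); first by exists p.
  by exists 0.
move=> /choice[k kP].
have kE p : circle p -> k (h p) = p.
  by move=> cp; have [|ck hk] := kP (h p); [exists p|exact: hi].
exists (h @` @circle R), k, h; split.
- split; last first.
    apply/subspace_continuousP => p cp W hW.
    have fst_c : (fst : R * R -> R) q @[q --> p] --> p.1 by exact: cvg_fst.
    have snd_c : (snd : R * R -> R) q @[q --> p] --> p.2 by exact: cvg_snd.
    have alW : nbhs (al p.1) W -> \forall q \near p, W (al q.1).
      by move=> nW; exact: (cvg_comp _ _ fst_c (alc _)) nW.
    have beW : nbhs (be p.1) W -> \forall q \near p, W (be q.1).
      by move=> nW; exact: (cvg_comp _ _ fst_c (bec _)) nW.
    suff : \forall q \near p, W (h q) by move=> nQ; exact: (@cvg_within _ (nbhs p) _ (@circle R) _ nQ).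
    have : nbhs (h p) W by exact: hW.
    rewrite /h.
    have [p0|p0|p0] := ltgtP 0 p.2.
    + move=> nW; have {}nW := alW nW; have n0 : \forall q \near p, 0 < q.2.
        by exact: (snd_c [set y | 0 < y] (lt_nbhsr p0)).
      near=> q; have q0 : 0 < q.2 by near: q.
      by rewrite /= (ltW q0); near: q.
    + move=> nW; have {}nW := beW nW; have n0 : \forall q \near p, q.2 < 0.
        by exact: (snd_c [set y | y < 0] (lt_nbhsl p0)).
      near=> q; have q0 : q.2 < 0 by near: q.
      by rewrite /= leNgt q0; near: q.
    (* At the two junction points both formulas give the same value. *)
    + move=> nW; have nA := alW nW; rewrite c20 // in nW; have nB := beW nW.
      by near=> q; rewrite /=; case: ifP => _; near: q.
  have sq_c (e : R) : continuous (fun x : R => (x, e * Num.sqrt (1 - x ^+ 2))).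
    have c2 : continuous (fun x : R => e * Num.sqrt (1 - x ^+ 2)).
      move=> x; apply: cvgM; first exact: cvg_cst.
      apply: (@continuous_comp _ _ _ (fun x : R => 1 - x ^+ 2) Num.sqrt).
        by apply: cvgB; [exact: cvg_cst|exact: exprn_continuous].
      exact: sqrt_continuous.
    by move=> x; exact: (cvg_pair (@cvg_id _ (nbhs x)) (c2 x)).
  (* On the image of [h], the preimage of a closed set under [k] is a union of two images of compact
     parameter sets, one for each half circle. *)
  apply/continuous_closedP => C cC; apply/closed_subspaceP.
  pose S (e : R) := [set x | -1 <= x <= 1] `&`
    (fun x : R => (x, e * Num.sqrt (1 - x ^+ 2))) @^-1` C.
  have cS e : compact (S e).
    apply: compact_closedI; first exact: compact_cc.
    by move/continuous_closedP: (sq_c e); exact.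
  have cI (g : R -> T) e : continuous g -> closed (g @` S e).
    move=> gc; apply: compact_closed; first exact: metric_hausdorff.
    by apply: continuous_compact; [exact: continuous_subspaceT|exact: cS].
  exists (al @` S 1 `|` be @` S (-1)); first by apply: closedU; exact: cI.
  have ons (x e : R) : -1 <= x <= 1 -> e ^+ 2 = 1 ->
      circle (x, e * Num.sqrt (1 - x ^+ 2)).
    by move=> x1 e1; rewrite /circle /= exprMn e1 mul1r sqr_sqrtr; nra.
  apply/seteqP; split=> a [ha Aa]; split=> //.
    case: ha => [[x [x1 Cx] <-]|[x [x1 Cx] <-]].
      have -> : al x = h (x, 1 * Num.sqrt (1 - x ^+ 2)).
        by rewrite /h /= mul1r sqrtr_ge0.
      suff : C (k (h (x, 1 * Num.sqrt (1 - x ^+ 2)))) by [].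
      by rewrite kE //; apply: ons => //; rewrite expr1n.
    have cx : circle (x, -1 * Num.sqrt (1 - x ^+ 2)).
      by apply: ons => //; rewrite sqrrN expr1n.
    have -> : be x = h (x, -1 * Num.sqrt (1 - x ^+ 2)).
      rewrite /h /= mulN1r; case: ifP => // s0; rewrite (c20 _ cx) //=.
      by have := sqrtr_ge0 (1 - x ^+ 2); lra.
    by suff : C (k (h (x, -1 * Num.sqrt (1 - x ^+ 2)))) by []; rewrite kE.
  have [cp hp] := kP a Aa; have Cka : C (k a) by exact: ha.
  rewrite -hp; move: cp (c1 _ cp) Cka {ha hp}; case: (k a) => x y cp /= x1 Cp.
  have yE : Num.sqrt (1 - x ^+ 2) = `|y|.
    by rewrite -sqrtr_sqr; congr Num.sqrt; move: cp; rewrite /circle /=; lra.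
  rewrite /h /=; case: ifPn => y0; [left|right]; exists x => //; split=> //=.
    by rewrite /preimage /= yE ger0_norm // mul1r.
  by rewrite /preimage /= yE ltr0_norm ?ltNge // mulN1r opprK.
- by move=> _ [a Aa <-]; have [] := kP a Aa.
- by move=> _ [p cp <-]; exists p.
- by move=> a /set_mem Aa; have [] := kP a Aa.
- by move=> p /set_mem cp; exact: kE.
Unshelve. all: by end_near.
Qed.

Lemma rooted_tree_reroot (R : realType) (T : topologicalType) (r : T)
    (I : finType) (D : {set I}) (dep : I -> nat) (sg : I -> R -> T)
    (ct : I -> T -> R) (a b : I) (t : R) :
  rooted_tree r D dep sg ct -> a \notin D -> b \in D -> sg b 0 = r ->
  0 < t < 1 ->
  exists (D' : {set I}) (dep' : I -> nat) (sg' : I -> R -> T) (ct' : I -> T -> R),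
    rooted_tree (sg b t) D' dep' sg' ct'.
Proof.
move=> rt aD bD b0 t01.
have ab : (a == b) = false by apply: contraNF aD => /eqP ->.
have inD v : v \in (a |: D)%SET -> v != a -> v \in D.
  by rewrite in_setU1 => /predU1P[->|//]; rewrite eqxx.
(* [ct v] is constant on [b] and vanishes at its base, the old root. *)
have neb v s : v \in D -> v != b -> 0 <= s <= 1 -> ct v (sg b s) = 0.
  move=> vD vb s01; rewrite eq_sym in vb.
  case: (ct_other rt bD vD vb) => c; first exact: c.
  have : ct v (sg b 0) = 1 by apply: c; rewrite lexx ler01.
  by rewrite b0 (ct_root rt) // => /esym/eqP; rewrite oner_eq0.
have t0 : t != 0 by rewrite gt_eqF //; lra.
have t1 : 1 - t != 0 by rewrite gt_eqF //; lra.
have tV : 0 < t^-1 by rewrite invr_gt0; lra.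
have t1V : 0 < (1 - t)^-1 by rewrite invr_gt0; lra.
pose dep' v := if v == a then 0%N else (dep v).+1.
pose sg' v := if v == a then fun s => sg b (t - s * t) else
  if v == b then fun s => sg b (t + s * (1 - t)) else sg v.
(* Rescaled cut functions of the two halves; the truncation at 0 flattens them on the far side of
   the new root. *)
pose ct' v := if v == a then fun x => Num.max 0 ((t - ct b x) / t) else
  if v == b then fun x => Num.max 0 ((ct b x - t) / (1 - t)) else ct v.
have up s : 0 <= s <= 1 -> 0 <= t + s * (1 - t) <= 1 by move=> ?; nra.
have dn s : 0 <= s <= 1 -> 0 <= t - s * t <= 1 by move=> ?; nra.
have upE s : (t + s * (1 - t) - t) / (1 - t) = s by rewrite addrAC subrr add0r mulfK.
have dnE s : (t - (t - s * t)) / t = s by rewrite opprB addrC subrK mulfK.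
exists (a |: D)%SET, dep', sg', ct'; split.
- move=> v vD; rewrite /sg'; case: eqVneq => [_|va].
    move=> s; apply: (@continuous_comp _ _ _ (fun s : R => t - s * t) (sg b)).
      by apply: cvgB; [exact: cvg_cst|apply: cvgM; [exact: cvg_id|exact: cvg_cst]].
    exact: (sg_continuous rt bD).
  case: eqVneq => [_|vb]; last exact: (sg_continuous rt (inD v vD va)).
  move=> s; apply: (@continuous_comp _ _ _ (fun s : R => t + s * (1 - t)) (sg b)).
    by apply: cvgD; [exact: cvg_cst|apply: cvgM; [exact: cvg_id|exact: cvg_cst]].
  exact: (sg_continuous rt bD).
- move=> v vD; rewrite /ct'; case: eqVneq => [_|va].
    move=> x; apply: (@continuous_max R T (cst 0)); first exact: cvg_cst.
    apply: cvgM; last exact: cvg_cst.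
    by apply: cvgB; [exact: cvg_cst|exact: (ct_continuous rt bD)].
  case: eqVneq => [_|vb]; last exact: (ct_continuous rt (inD v vD va)).
  move=> x; apply: (@continuous_max R T (cst 0)); first exact: cvg_cst.
  apply: cvgM; last exact: cvg_cst.
  by apply: cvgB; [exact: (ct_continuous rt bD)|exact: cvg_cst].
- have tt : 0 <= t <= 1 by lra.
  move=> v vD; rewrite /ct'; case: eqVneq => [_|va].
    by rewrite (ct_sg rt) // subrr mul0r maxxx.
  case: eqVneq => [_|vb]; last by apply: neb => //; exact: inD.
  by rewrite (ct_sg rt) // subrr mul0r maxxx.
- move=> v s vD s01; rewrite /ct' /sg'; case: eqVneq => [_|va].
    by rewrite (ct_sg rt) ?dn // dnE; apply/max_idPr; lra.
  case: eqVneq => [_|vb]; last by apply: (ct_sg rt) => //; exact: inD.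
  by rewrite (ct_sg rt) ?up // upE; apply/max_idPr; lra.
- move=> u v uD vD uv; rewrite /ct' /sg'.
  have [vE|va] := eqVneq v a.
    have [uE|ua] := eqVneq u a; first by rewrite uE vE eqxx in uv.
    have [uE|ub] := eqVneq u b.
      left=> s s01; rewrite (ct_sg rt) ?up //; apply/max_idPl.
      by rewrite pmulr_lle0 //; nra.
    case: (ct_other rt (inD u uD ua) bD ub) => c; [right|left] => s s01; rewrite c //.
      by rewrite subr0 divff //; apply/max_idPr; lra.
    by apply/max_idPl; rewrite pmulr_lle0 //; lra.
  have [vE|vb] := eqVneq v b.
    have [uE|ua] := eqVneq u a.
      left=> s s01; rewrite (ct_sg rt) ?dn //; apply/max_idPl.
      by rewrite pmulr_lle0 //; nra.
    have [uE|ub] := eqVneq u b; first by rewrite uE vE eqxx in uv.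
    case: (ct_other rt (inD u uD ua) bD ub) => c; [left|right] => s s01; rewrite c //.
      by apply/max_idPl; rewrite pmulr_lle0 //; lra.
    by rewrite divff //; apply/max_idPr; lra.
  have vD' := inD v vD va.
  have [uE|ua] := eqVneq u a; first by left=> s s01; rewrite neb ?dn.
  have [uE|ub] := eqVneq u b; first by left=> s s01; rewrite neb ?up.
  exact: (ct_other rt (inD u uD ua) vD' uv).
- move=> v vD; rewrite /sg' /dep'; have [vE|va] := eqVneq v a.
    by left; rewrite mul0r subr0.
  have [vE|vb] := eqVneq v b; first by left; rewrite mul0r addr0.
  right; case: (sg_base rt (inD v vD va)) => [->|[w [wD wv ->]]].
    (* An edge that started at the old root now starts at the top of [a]. *)
    by exists a; rewrite eqxx mul1r subrr b0 setU11.
  exists w; rewrite in_setU1 wD orbT.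
  have wa : (w == a) = false by apply: contraNF aD => /eqP <-.
  split=> //; first by rewrite wa ltnS.
  by rewrite wa; case: eqVneq => [->|//]; rewrite mul1r subrKC.
- move=> x; have Da v : v \in D -> v \in (a |: D)%SET.
    by move=> vD; rewrite in_setU1 vD orbT.
  case: (sg_cover rt x) => [->|[v [s [vD s01 ->]]]].
    right; exists a, 1; rewrite setU11 ltr01 lexx; split=> //.
    by rewrite /sg' eqxx mul1r subrr b0.
  have va : (v == a) = false by apply: contraNF aD => /eqP <-.
  have [vb|vb] := eqVneq v b; last first.
    by right; exists v, s; rewrite Da // /sg' va (negbTE vb).
  rewrite vb; have [st|ts|->] := ltgtP s t; last by left.
    right; exists a, ((t - s) / t); rewrite setU11; split=> //; last first.
      by rewrite /sg' eqxx mulfVK // opprB addrC subrK.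
    by rewrite divr_gt0 ?ler_pdivrMr //; lra.
  right; exists b, ((s - t) / (1 - t)); rewrite Da //; split=> //; last first.
    by rewrite /sg' eq_sym ab eqxx mulfVK // subrKC.
  by rewrite divr_gt0 ?ler_pdivrMr //; lra.
Qed.

(** * Continuity and barycentric coordinates in the carrier *)

Lemma mx_continuous (S T : topologicalType) (m n : nat) (g : S -> 'M[T]_(m, n)) :
  (forall i j, continuous (fun s => g s i j)) -> continuous g.
Proof.
move=> gc s B [P PM PB]; apply: (@filterS _ (nbhs s) _
  [set s' | forall i j, P i j (g s' i j)]).
  by move=> s' Ps'; exact: PB.
apply: filter_forall => i; apply: filter_forall => j.
exact: gc (PM i j).
Qed.

Lemma continuous_comp_within (S X Y : topologicalType) (B : set X)
    (g : S -> X) (h : X -> Y) :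
  {within B, continuous h} -> continuous g -> (forall s, B (g s)) ->
  continuous (h \o g).
Proof.
move=> /subspace_continuousP hc gc gB s W hW.
have : \forall s' \near s, B (g s') -> W (h (g s')).
  exact: gc (hc _ (gB s) _ hW).
by apply: filterS => s'; apply.
Qed.

(** Retraction onto [[0, k]], extending a path parametrized by that interval to a continuous
    function on all reals, as [rooted_tree] asks. *)
Definition clamp (R : realType) (k t : R) : R := Num.max 0 (Num.min k t).

Lemma clamp_continuous (R : realType) (k : R) : continuous (clamp k).
Proof.
move=> t; apply: (@continuous_max R R (cst 0)); first exact: cvg_cst.
by apply: (@continuous_min R R (cst k)); [exact: cvg_cst|exact: cvg_id].
Qed.

Lemma clamp_id (R : realType) (k t : R) : 0 <= t <= k -> clamp k t = t.
Proof. by move=> /andP[t0 tk]; rewrite /clamp (min_idPr tk) (max_idPr t0). Qed.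

Lemma clamp_itv (R : realType) (k t : R) : 0 <= k -> 0 <= clamp k t <= k.
Proof. by move=> k0; rewrite /clamp le_max lexx ge_max k0 ge_min lexx. Qed.

(* Barycentric coordinates on the segment from the vertex [u] to the vertex
   [v]; [bary v v 0] is the vertex [v]. *)
Definition bary (R : realType) (n : nat) (u v : 'I_n) (t : R) : 'rV[R]_n :=
  \row_i ((1 - t) * (i == u)%:R + t * (i == v)%:R).

Definition adj (n : nat) (K : {set {set 'I_n}}) : rel 'I_n :=
  fun u v => (u != v) && ([set u; v]%SET \in K).

Section Carrier.
Variables (R : realType) (n : nat) (K : {set {set 'I_n}}).
Hypotheses (sK : simplicial_complex K) (oK : one_dimensional K).

Lemma adj_sym : symmetric (adj K).
Proof. by move=> u v; rewrite /adj eq_sym finset.setUC. Qed.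

Lemma adj_vertex u v : adj K u v -> [set u]%SET \in K.
Proof.
move=> /andP[_ uvK]; apply: sK.2 uvK _ _; last by rewrite -card_gt0 cards1.
by rewrite finset.sub1set finset.setU11.
Qed.

Lemma baryC (u v : 'I_n) (t : R) : bary u v t = bary v u (1 - t).
Proof. by apply/rowP => i; rewrite !mxE subKr addrC. Qed.

Lemma bary0 (u v : 'I_n) : bary u v 0 = bary u u 0 :> 'rV[R]_n.
Proof. by apply/rowP => i; rewrite !mxE !mul0r. Qed.

Lemma bary1 (u v : 'I_n) : bary u v 1 = bary v v 0 :> 'rV[R]_n.
Proof. by rewrite baryC subrr bary0. Qed.

Lemma sum_bary (P : pred 'I_n) (u v : 'I_n) (t : R) :
  \sum_(i | P i) bary u v t 0 i = (1 - t) * (P u)%:R + t * (P v)%:R.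
Proof.
have delta (w : 'I_n) : \sum_(i | P i) (i == w)%:R = (P w)%:R :> R.
  rewrite (big_mkcond P) (bigD1 w) //= eqxx big1 ?addr0; first by case: (P w).
  by move=> i /negbTE ->; case: ifP.
under eq_bigr do rewrite mxE.
by rewrite big_split /= -!mulr_sumr !delta.
Qed.

Lemma bary_continuous (u v : 'I_n) : continuous (@bary R n u v).
Proof.
apply: mx_continuous => i j t.
under [X in continuous_at _ X]eq_fun => s do rewrite mxE.
apply: cvgD; apply: cvgM; try exact: cvg_cst; last exact: cvg_id.
by apply: cvgB; [exact: cvg_cst|exact: cvg_id].
Qed.

Lemma mem_carrier (x : 'rV[R]_n) (s : {set 'I_n}) :
  (forall i, 0 <= x 0 i) -> \sum_i x 0 i = 1 -> s \in K ->
  (forall i, x 0 i != 0 -> i \in s) -> carrier K x.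
Proof.
move=> x0 x1 sinK xs; split=> //; apply: sK.2 sinK _ _.
  by apply/fintype.subsetP => i; rewrite inE; exact: xs.
apply/eqP => S0; move: x1; rewrite big1 => [/esym/eqP|i _]; first by rewrite oner_eq0.
apply/eqP/negPn/negP => xi.
by have := finset.in_set0 i; rewrite -S0 inE xi.
Qed.

Lemma bary_carrier (u v : 'I_n) (t : R) :
  adj K u v -> 0 <= t <= 1 -> carrier K (bary u v t).
Proof.
move=> /andP[uv uvK] t01; apply: mem_carrier uvK _ => [i||i].
- by rewrite mxE; case: eqP => _; case: eqP => _; rewrite ?mulr1 ?mulr0; lra.
- by rewrite (sum_bary predT) /=; lra.
- rewrite mxE !inE; case: (i =P u) => _ //; case: (i =P v) => _ //.
  by rewrite !mulr0 addr0 eqxx.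
Qed.

Lemma vertex_carrier (v : 'I_n) :
  [set v]%SET \in K -> carrier K (bary v v 0 : 'rV[R]_n).
Proof.
move=> vK; apply: mem_carrier vK _ => [i||i].
- by rewrite mxE subr0 mul0r addr0 mul1r ler0n.
- by rewrite (sum_bary predT) /= subr0 mul0r addr0 mulr1.
- by rewrite mxE !inE; case: (i =P v) => // _; rewrite !mulr0 addr0 eqxx.
Qed.

(** The support of [x] is a simplex, so in dimension one it has one or two vertices; with two, the
    parameter is the coordinate at the second. *)
Lemma carrier_cases (x : 'rV[R]_n) : carrier K x ->
  (exists2 v, [set v]%SET \in K & x = bary v v 0) \/
  (exists u v t, [/\ adj K u v, 0 < t < 1 & x = bary u v t]).
Proof.
move=> [x0 x1]; set S := finset _ => SK.
have SE i : (i \in S) = (x 0 i != 0) by rewrite inE.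
have : (#|S| <= 2)%N by rewrite -oK; exact: leq_bigmax_cond.
have S0 : (0 < #|S|)%N.
  by rewrite card_gt0; apply: contraNneq sK.1 => <-.
have xS : \sum_(i in S) x 0 i = 1.
  rewrite -x1 [RHS](bigID (mem S)) /= [X in _ = _ + X]big1 ?addr0 // => i.
  by rewrite SE negbK => /eqP.
rewrite leq_eqVlt ltnS => /orP[/cards2P[u [v [uv SE']]]|S1]; last first.
  have /cards1P[v Sv] : #|S| == 1%N by rewrite eqn_leq S1.
  left; exists v; first by rewrite -Sv.
  move: xS; rewrite Sv finset.big_set1 => xv; apply/rowP => i; rewrite mxE.
  rewrite subr0 mul0r addr0 mul1r; case: eqVneq => [->//|iv].
  by apply/eqP; move: (SE i); rewrite Sv inE (negbTE iv) => /esym/negbFE.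
right; exists u, v, (x 0 v).
have xuv : x 0 u + x 0 v = 1.
  by rewrite -xS SE' finset.big_setU1 ?finset.big_set1 // inE.
have [xu xv] : 0 < x 0 u /\ 0 < x 0 v.
  by rewrite !lt_neqAle !x0 !andbT !(eq_sym 0) -!SE SE' !inE !eqxx orbT.
split; [by rewrite /adj uv -SE'|by lra|].
apply/rowP => i; rewrite mxE; have [->|iu] := eqVneq i u.
  by rewrite (negbTE uv) mulr0 addr0 mulr1; lra.
have [->|iv] := eqVneq i v; first by rewrite mulr0 add0r mulr1.
apply/eqP; rewrite !mulr0 addr0.
by move: (SE i); rewrite SE' !inE (negbTE iu) (negbTE iv) => /esym/negbFE.
Qed.

End Carrier.

(** * Polygonal paths in the carrier *)

Definition hat (R : realType) (s : R) : R := Num.max 0 (1 - `|s|).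

Lemma hat_continuous (R : realType) : continuous (@hat R).
Proof.
move=> t; apply: (@continuous_max R R (cst 0) (fun s => 1 - `|s|)); first exact: cvg_cst.
by apply: cvgB; [exact: cvg_cst|exact: norm_continuous].
Qed.

Lemma hat_ge1 (R : realType) (s : R) : 1 <= `|s| -> hat s = 0.
Proof. by move=> s1; apply/max_idPl; lra. Qed.

Lemma hat_le1 (R : realType) (s : R) : `|s| <= 1 -> hat s = 1 - `|s|.
Proof. by move=> s1; apply/max_idPr; lra. Qed.

(* Unit-speed parametrization of the polygonal path through the vertices [s]. *)
Definition polyline (R : realType) (n : nat) (s : seq 'I_n) (t : R) : 'rV[R]_n :=
  \row_j (if j \in s then hat (t - (index j s)%:R) else 0).

Lemma polyline_continuous (R : realType) (n : nat) (s : seq 'I_n) :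
  continuous (@polyline R n s).
Proof.
apply: mx_continuous => i j t.
under [X in continuous_at _ X]eq_fun => r do rewrite mxE.
case: (j \in s); last exact: cvg_cst.
apply: (@continuous_comp _ _ _ (fun r : R => r - (index j s)%:R) (@hat R)).
  by apply: cvgB; [exact: cvg_id|exact: cvg_cst].
exact: hat_continuous.
Qed.

Lemma unit_interval_of (R : realType) (k : nat) (t : R) : 0 <= t <= k.+1%:R ->
  exists2 i, (i <= k)%N & i%:R <= t <= i.+1%:R.
Proof.
elim: k => [|k IH] t0k; first by exists 0%N.
have [tk|tk] := leP t k.+1%:R; last first.
  by exists k.+1 => //; case/andP: t0k => _ ->; rewrite ltW.
have [|i ik it] := IH; first by case/andP: t0k => -> _.
by exists i => //; exact: leqW.
Qed.

(** Between the times [i] and [i.+1], all vertices of other indices are at distance at least 1,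
    where the tent function [hat] vanishes. *)
Lemma polylineP (R : realType) (n : nat) (u : 'I_n) (p : seq 'I_n) (t : R) :
  uniq (u :: p) -> (0 < size p)%N -> 0 <= t <= (size p)%:R ->
  exists i th, [/\ (i < size p)%N, 0 <= th <= 1, t = i%:R + th &
    polyline (u :: p) t = bary (nth u (u :: p) i) (nth u p i) th].
Proof.
move=> up p0 t0; have := t0; rewrite -{1}(prednK p0).
move=> /unit_interval_of[i ip it].
have {}ip : (i < size p)%N by rewrite -(prednK p0).
exists i, (t - i%:R); rewrite subrKC; split=> //.
  by move: it; rewrite -[i.+1%:R]natr1; lra.
apply/rowP => j; rewrite !mxE.
have -> : nth u p i = nth u (u :: p) i.+1 by [].
move: up; set s := u :: p => us.
have is1 : (i.+1 < size s)%N by [].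
have is0 : (i < size s)%N by exact: ltnW.
have [js|jNs] := boolP (j \in s); last first.
  by rewrite !(negbTE (contraNneq _ jNs)) ?mulr0 ?addr0 // => ->; exact: mem_nth.
have jE m : (m < size s)%N -> (j == nth u s m) = (index j s == m).
  by move=> ms; rewrite -{1}(nth_index u js) nth_uniq // index_mem.
rewrite !jE //; move: it; set m := index j s; rewrite -[i.+1%:R]natr1 => it.
have [->|mi] := eqVneq m i.
  rewrite (ltn_eqF (ltnSn _)) mulr0 addr0 mulr1 hat_le1 ger0_norm; lra.
have [->|mi1] := eqVneq m i.+1.
  by rewrite mulr0 add0r mulr1 -[i.+1%:R]natr1 hat_le1 ler0_norm; lra.
rewrite !mulr0 addr0; apply: hat_ge1.
move: mi; rewrite neq_ltn => /orP[mi|im].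
  have : m.+1%:R <= i%:R :> R by rewrite ler_nat.
  by rewrite -[m.+1%:R]natr1 => ?; rewrite ger0_norm; lra.
have : i.+2%:R <= m%:R :> R by rewrite ler_nat ltn_neqAle eq_sym mi1.
by rewrite -[i.+2%:R]natr1 -[i.+1%:R]natr1 => ?; rewrite ler0_norm; lra.
Qed.

(** Weighting each coordinate by the index of its vertex gives a linear functional that recovers the
    time. *)
Lemma polyline_inj (R : realType) (n : nat) (u : 'I_n) (p : seq 'I_n) (s t : R) :
  uniq (u :: p) -> (0 < size p)%N ->
  0 <= s <= (size p)%:R -> 0 <= t <= (size p)%:R ->
  polyline (u :: p) s = polyline (u :: p) t -> s = t.
Proof.
move=> up p0; pose l (x : 'rV[R]_n) := \sum_j (index j (u :: p))%:R * x 0 j.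
suff lE r : 0 <= r <= (size p)%:R -> l (polyline (u :: p) r) = r.
  by move=> s0 t0 st; rewrite -(lE s) // st lE.
move=> r0; have [i [th [ip th01 -> ->]]] := polylineP up p0 r0.
have lb (v w : 'I_n) : l (bary v w th) =
    (1 - th) * (index v (u :: p))%:R + th * (index w (u :: p))%:R.
  have delta (x : 'I_n) :
      \sum_j (index j (u :: p))%:R * (j == x)%:R = (index x (u :: p))%:R :> R.
    rewrite (bigD1 x) //= eqxx mulr1 big1 ?addr0 // => j /negbTE ->.
    exact: mulr0.
  rewrite /l -!delta !mulr_sumr -big_split /=; apply: eq_bigr => j _.
  by rewrite mxE; lra.
rewrite lb -[nth u p i]/(nth u (u :: p) i.+1) !index_uniq //; last exact: ltnW.
by rewrite -[i.+1%:R]natr1; lra.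
Qed.

(** * Spanning trees of a graph without circles *)

Section Graph.
Variables (R : realType) (T : metricType R) (n : nat) (K : {set {set 'I_n}}).
Variables (phi : T -> 'rV[R]_n) (psi : 'rV[R]_n -> T).
Hypotheses (sK : simplicial_complex K) (oK : one_dimensional K).
Hypotheses (phi_c : continuous phi) (psi_c : {within carrier K, continuous psi}).
Hypotheses (phi_carrier : forall x, carrier K (phi x)) (phiK : cancel phi psi).
Hypothesis psiK : forall x, carrier K x -> phi (psi x) = x.

Lemma psi_inj x y : carrier K x -> carrier K y -> psi x = psi y -> x = y.
Proof. by move=> cx cy e; rewrite -(psiK cx) e psiK. Qed.

(** The path and the closing edge are two arcs with the same ends. They meet nowhere else, because
    the path is simple and has at least two edges. *)
Lemma cycle_circle (u : 'I_n) (p : seq 'I_n) :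
  path (adj K) u p -> uniq (u :: p) -> (1 < size p)%N -> adj K u (last u p) ->
  exists A : set T, homeomorphic A (@circle R).
Proof.
move=> up uq p1 uw; set w := last u p in uw.
have p0 : (0 < size p)%N by exact: ltnW.
have pR : 0 < (size p)%:R :> R by rewrite ltr0n.
have adjE i : (i < size p)%N -> adj K (nth u (u :: p) i) (nth u p i).
  by move/(pathP u): up; exact.
have polyC (t : R) : 0 <= t <= (size p)%:R -> carrier K (polyline (u :: p) t).
  by move=> /(polylineP uq p0)[i [th [ip th01 _ ->]]]; apply: bary_carrier => //; exact: adjE.
(* Carries [[-1, 1]], the parameter interval of [two_arcs_circle], onto [[0, 1]]. *)
pose c t : R := clamp 1 ((t + 1) / 2).
have c_c : continuous c.
  move=> t; apply: (@continuous_comp _ _ _ (fun t : R => (t + 1) / 2)).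
    by apply: cvgM; [apply: cvgD; [exact: cvg_id|exact: cvg_cst]|exact: cvg_cst].
  exact: clamp_continuous.
have c01 t : 0 <= c t <= 1 by exact: clamp_itv.
have cE t : -1 <= t <= 1 -> c t = (t + 1) / 2 by move=> ?; rewrite /c clamp_id //; lra.
have ck t : 0 <= c t * (size p)%:R <= (size p)%:R.
  by case/andP: (c01 t) => c0 c1; rewrite mulr_ge0 ?ler_piMl // ltW.
have w_nth : w = nth u (u :: p) (size p) by rewrite /w (last_nth u).
have bC t : carrier K (bary u w (c t)) by exact: bary_carrier.
have p_first : polyline (u :: p) 0 = bary u u 0 :> 'rV[R]_n.
  have [|i [th [ip th01]]] := polylineP uq p0 (t := 0 : R); first by rewrite lexx ltW.
  have i0 : 0 <= i%:R :> R by [].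
  move=> t0; have [iE ->] : i%:R = 0 :> R /\ th = 0 by split; lra.
  move: iE => /eqP; rewrite pnatr_eq0 => /eqP ->.
  by rewrite bary0.
have p_last : polyline (u :: p) (size p)%:R = bary w w 0 :> 'rV[R]_n.
  have [|i [th [ip th01]]] := polylineP uq p0 (t := (size p)%:R : R).
    by rewrite lexx ltW.
  have iR : i%:R <= (size p).-1%:R :> R by rewrite ler_nat -ltnS prednK.
  have pE : (size p)%:R = (size p).-1%:R + 1 :> R by rewrite natr1 prednK.
  move=> t0; have [iE ->] : i%:R = (size p).-1%:R :> R /\ th = 1 by split; lra.
  move: iE => /eqP; rewrite eqr_nat => /eqP ->.
  by rewrite bary1 nth_last.
apply: (@two_arcs_circle R T (psi \o (fun t => polyline (u :: p) (c t * (size p)%:R)))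
  (psi \o (fun t => bary u w (c t)))).
- apply: continuous_comp_within psi_c _ _ => [t|t]; last exact: polyC.
  apply: (@continuous_comp _ _ _ (fun t => c t * (size p)%:R)).
    by apply: cvgM; [exact: c_c|exact: cvg_cst].
  exact: polyline_continuous.
- apply: continuous_comp_within psi_c _ _ => [t|t]; last exact: bC.
  by apply: continuous_comp; [exact: c_c|exact: bary_continuous].
- move=> s t s1 t1 /(psi_inj (polyC _ (ck s)) (polyC _ (ck t))).
  move=> /(polyline_inj uq p0 (ck s) (ck t)).
  by move=> /(mulIf (lt0r_neq0 pR)); rewrite !cE //; lra.
- move=> s t s1 t1 /(psi_inj (bC s) (bC t))/(congr1 (fun x : 'rV[R]_n => x 0 w)).
  rewrite !mxE eqxx; have /negbTE -> : w != u by case/andP: uw; rewrite eq_sym.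
  by rewrite !mulr0 !add0r !mulr1 !cE //; lra.
- have cm : c (-1) = 0 by rewrite cE; lra.
  by rewrite /= cm mul0r p_first bary0.
- have cm : c 1 = 1 by rewrite cE; lra.
  by rewrite /= cm mul1r p_last bary1.
move=> s t s1 t1 /(psi_inj (polyC _ (ck s)) (bC t)).
have [i [th [ip _ _ ->]]] := polylineP uq p0 (ck s) => e.
have [->|tm1] := eqVneq t (-1); first by left.
have [->|tp1] := eqVneq t 1; first by right.
have ct : 0 < c t < 1.
  have : -1 < t < 1 by rewrite !lt_neqAle tp1 eq_sym tm1.
  by rewrite cE //; lra.
(* An interior point of the closing edge has positive coordinates at [u] and [w], so a single edge
   of the path would contain both of its ends, leaving the path at most one edge. *)
have mem (j : 'I_n) : 0 < bary u w (c t) 0 j ->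
    j = nth u (u :: p) i \/ j = nth u (u :: p) i.+1.
  rewrite -e mxE; case: eqVneq => [|_]; first by left.
  by case: eqVneq => [|_]; [right|rewrite !mulr0 addr0 ltxx].
have uw' : u != w by case/andP: uw.
have mu : 0 < bary u w (c t) 0 u.
  by rewrite mxE eqxx (negbTE uw') mulr0 addr0 mulr1; lra.
have mw : 0 < bary u w (c t) 0 w.
  by rewrite mxE eqxx eq_sym (negbTE uw') mulr0 add0r mulr1; lra.
have nthI k l : (k <= size p)%N -> (l <= size p)%N ->
    nth u (u :: p) k = nth u (u :: p) l -> k = l.
  by move=> kp lp /eqP; rewrite nth_uniq // => /eqP.
have i0 : i = 0%N.
  case: (mem u mu) => [/(nthI 0%N i isT (ltnW ip))//|].
  by move=> /(nthI 0%N i.+1 isT ip).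
case: (mem w mw); rewrite w_nth i0.
  by move=> /(nthI _ _ (leqnn _) (leq0n _)) p00; rewrite p00 in p1.
by move=> /(nthI _ _ (leqnn _) p0) p11; rewrite p11 in p1.
Qed.

Hypothesis kT : connected [set: T].
Hypothesis noC : ~ exists A : set T, homeomorphic A (@circle R).

Lemma coord_sum_continuous (P : pred 'I_n) :
  continuous (fun x : T => \sum_(i | P i) phi x 0 i).
Proof.
move=> x; elim: (index_enum _) => [|i e IH].
  under [X in continuous_at _ X]eq_fun => y do rewrite big_nil.
  exact: cvg_cst.
under [X in continuous_at _ X]eq_fun => y do rewrite big_cons.
case: (P i) => //; apply: cvgD => //.
apply: (@continuous_comp _ _ _ phi (fun M : 'rV[R]_n => M 0 i)); first exact: phi_c.
exact: coord_continuous.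
Qed.

(** The sum of the coordinates over the component of [r] is 0 or 1 everywhere, since an edge stays
    in one component; on a connected space it cannot take both values. *)
Lemma vertices_connected (r v : 'I_n) :
  [set r]%SET \in K -> [set v]%SET \in K -> connect (adj K) r v.
Proof.
move=> rK vK; apply/negPn/negP => rNv.
pose P := [pred i | connect (adj K) r i].
have valP w : [set w]%SET \in K ->
    \sum_(i | P i) phi (psi (bary w w 0)) 0 i = (P w)%:R.
  move=> wK; rewrite psiK; last exact: vertex_carrier.
  by rewrite sum_bary subr0 mul1r mul0r addr0.
have [x _ xh] : exists2 x, [set: T] x & \sum_(i | P i) phi x 0 i = 1 / 2.
  apply: (connected_ivt kT (@coord_sum_continuous P) (x := psi (bary v v 0))
    (y := psi (bary r r 0))) => //.
  by rewrite !valP //= (negbTE rNv) connect0 /=; lra.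
case: (carrier_cases sK oK (phi_carrier x)) => [[w wK xw]|[u [w [t [uw t01 xuw]]]]].
  by move: xh; rewrite xw sum_bary; case: (P w) => /=; lra.
move: xh; rewrite xuw sum_bary /=.
have -> : connect (adj K) r w = connect (adj K) r u.
  by apply/esym/same_connect_r; [exact/sym_connect_sym/adj_sym|exact: connect1].
by case: (connect _ _ _) => /=; lra.
Qed.

(** The depth is the distance from [r], and the parent is the last vertex but one on a shortest
    path. *)
Lemma bfs_parent (r : 'I_n) : exists (dep : 'I_n -> nat) (par : 'I_n -> 'I_n),
  forall v, connect (adj K) r v -> v != r ->
    adj K (par v) v /\ (dep (par v) < dep v)%N.
Proof.
have /choice[dep depP] : forall v, exists d, connect (adj K) r v ->
    (exists p, [/\ path (adj K) r p, last r p = v & size p = d]) /\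
    (forall p, path (adj K) r p -> last r p = v -> (d <= size p)%N).
  move=> v.
  have [rv|] := boolP (connect (adj K) r v); last by exists 0%N.
  pose Q m := `[< exists p, [/\ path (adj K) r p, last r p = v & size p = m] >].
  have Qex : exists m, Q m.
    by have /connectP[p rp pv] := rv; exists (size p); apply/asboolP; exists p.
  exists (ex_minn Qex); case: ex_minnP => m /asboolP mQ mmin _; split=> //.
  by move=> p rp pv; apply: mmin; apply/asboolP; exists p.
suff /choice[par parP] : forall v, exists w, connect (adj K) r v -> v != r ->
    adj K w v /\ (dep w < dep v)%N by exists dep, par.
move=> v; have [rv|] := boolP (connect (adj K) r v); last by exists v.
have [[p [rp pv ps]] _] := depP v rv.
case/lastP: p rp pv ps => [_ <- _|p w]; first by exists r => _; rewrite eqxx.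
rewrite rcons_path last_rcons size_rcons => /andP[rp pw] <- <-.
exists (last r p) => _ _; split=> //; rewrite ltnS.
have [|_ dmin] := depP (last r p); first by apply/connectP; exists p.
exact: dmin.
Qed.

(** An edge is indexed by its end [v] away from the root, the other end being [par v]. That [r] is a
    free index and that every edge belongs to the tree serves to reroot at interior points of
    edges. *)
Lemma rooted_tree_vertex (r : 'I_n) : [set r]%SET \in K ->
  exists (par : 'I_n -> 'I_n) (D : {set 'I_n}) (dep : 'I_n -> nat)
      (ct : 'I_n -> T -> R),
    [/\ rooted_tree (psi (bary r r 0)) D dep
          (fun v => psi \o (bary (par v) v \o clamp 1)) ct,
        r \notin D &
        forall u v, adj K u v -> v \in D /\ par v = u \/ u \in D /\ par u = v].
Proof.
move=> rK; have [dep [par parP]] := bfs_parent r.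
pose D := [set v | ([set v]%SET \in K) && (v != r)]%SET.
have DP v : v \in D -> [/\ [set v]%SET \in K, v != r, adj K (par v) v &
    (dep (par v) < dep v)%N].
  rewrite inE => /andP[vK vr]; have [] := parP v _ vr => //.
  exact: vertices_connected.
have rD : r \notin D by rewrite inE eqxx andbF.
have inD v : [set v]%SET \in K -> v != r -> v \in D by rewrite inE => -> ->.
pose te := [rel x y | (x \in D) && (par x == y)].
pose e' := [rel x y | te x y || te y x].
have e'_adj x y : e' x y -> adj K x y.
  by move=> /= /orP[]/andP[/DP[_ _ xy _] /eqP <-] //; rewrite adj_sym.
have e'r v : [set v]%SET \in K -> connect e' v r.
  have [m] := ubnP (dep v); elim: m v => // m IH v /ltnSE dv vK.
  have [->|vr] := eqVneq v r; first exact: connect0.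
  have vD := inD v vK vr; have [_ _ pv dp] := DP v vD.
  apply: (connect_trans (y := par v)).
    by apply: connect1; rewrite /= vD eqxx.
  by apply: IH; [exact: leq_trans dv|exact: adj_vertex pv].
have tree u v : adj K u v -> v \in D /\ par v = u \/ u \in D /\ par u = v.
  move=> uv; have [/orP[]/andP[xD /eqP xy]|nuv] := boolP (e' u v).
  - by right.
  - by left.
  (* An edge off the tree would close up the tree path between its ends to a circle. *)
  case: noC; have e's : connect_sym e'.
    by apply: sym_connect_sym => x y; rewrite /= orbC.
  have vu : adj K v u by rewrite adj_sym.
  have : connect e' u v.
    apply: (connect_trans (y := r)); first exact/e'r/(adj_vertex sK uv).
    by rewrite e's; exact/e'r/(adj_vertex sK vu).
  move=> /connectP[p0 up0]; case/shortenP: up0 => p up uq _ vE.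
  apply: (@cycle_circle u p) => //; last by rewrite -vE.
    by apply: sub_path up; exact: e'_adj.
  (* A tree path with a single edge would be the edge from [u] to [v] itself. *)
  case: p up vE {uq} => [_ vE|w [/=|//]].
    by move: uv; rewrite vE /adj eqxx.
  by rewrite andbT => uw vE; move: nuv; rewrite vE /= uw.
(* Cutting the edge [v] separates the descendants of [v] from the rest; every other tree edge has
   both ends on one side ([desc_par]). *)
pose desc v := [pred i | connect te i v].
have desc_par u v : u \in D -> u != v -> desc v (par u) = desc v u.
  move=> uD uv; apply/idP/idP => /= [|/connectP[[|w p]]].
  - by apply: connect_trans; apply: connect1; rewrite /= uD eqxx.
  - by move=> _ vE; rewrite vE eqxx in uv.
  - by move=> /= /andP[/andP[_ /eqP ->] wp] vE; apply/connectP; exists p.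
have desc_dep i v : desc v i -> (dep v <= dep i)%N.
  move=> /= /connectP[p]; elim: p i => [i _ ->//|w p IH i /=].
  move=> /andP[/andP[iD /eqP <-] pp] vE; have [_ _ _ /ltnW] := DP i iD.
  by apply: leq_trans; exact: IH.
have desc_parN v : v \in D -> desc v (par v) = false.
  move=> vD; apply/negP => /desc_dep; have [_ _ _] := DP v vD.
  by rewrite ltnNge => /negP.
have desc_root v : v \in D -> desc v r = false.
  move=> vD; apply/negP => /= /connectP[[|w p]] /=.
    by move=> _ vr; rewrite vr (negbTE rD) in vD.
  by rewrite (negbTE rD).
have adj_par v : v \in D -> adj K (par v) v by move=> /DP[].
have c01 (t : R) : 0 <= clamp 1 t <= 1 by exact: clamp_itv.
pose ct v x := \sum_(i | desc v i) phi x 0 i.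
have ct_bary v u w (t : R) : adj K u w -> 0 <= t <= 1 ->
    ct v (psi (bary u w t)) = (1 - t) * (desc v u)%:R + t * (desc v w)%:R.
  by move=> uw t01; rewrite /ct psiK ?sum_bary //; exact: bary_carrier.
exists par, D, dep, ct; split=> //; split.
- move=> v vD; apply: continuous_comp_within psi_c _ _ => [t|t].
    by apply: continuous_comp; [exact: clamp_continuous|exact: bary_continuous].
  by apply: bary_carrier; [exact: sK|exact: adj_par|exact: c01].
- by move=> v vD; exact: coord_sum_continuous.
- move=> v vD; rewrite /ct psiK; last exact: vertex_carrier.
  by rewrite sum_bary desc_root // !mulr0 addr0.
- move=> v t vD t01; rewrite /= clamp_id // ct_bary //; last exact: adj_par.
  by rewrite desc_parN // /desc /= connect0 mulr0 add0r mulr1.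
- move=> u v uD vD uv; case duv : (desc v u); [right|left] => t t01;
  rewrite /= clamp_id // ct_bary ?desc_par // ?duv; try exact: adj_par.
    by rewrite !mulr1; lra.
  by rewrite !mulr0 addr0.
- have i01 : 0 <= (0 : R) <= 1 /\ 0 <= (1 : R) <= 1 by split; lra.
  move=> v vD; have [vK vr pv dp] := DP v vD.
  rewrite /= clamp_id ?i01.1 // bary0.
  have [->|pr] := eqVneq (par v) r; first by left.
  right; exists (par v); split=> //; first exact: inD (adj_vertex sK pv) pr.
  by rewrite /= clamp_id ?i01.2 // bary1.
- move=> x; case: (carrier_cases sK oK (phi_carrier x)) => [[w wK xw]|].
    have [wr|wr] := eqVneq w r; first by left; rewrite -(phiK x) xw wr.
    right; exists w, 1; rewrite inD // ltr01 lexx; split=> //.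
    by rewrite -(phiK x) xw /= clamp_id ?ler01 ?lexx // bary1.
  move=> [u [w [t [uw t01 xE]]]]; right.
  case: (tree u w uw) => -[vD vE].
    exists w, t; split=> //; first by lra.
    by rewrite -(phiK x) xE /= vE clamp_id //; lra.
  exists u, (1 - t); split=> //; first by lra.
  by rewrite -(phiK x) xE /= vE baryC clamp_id //; lra.
Qed.

(** A vertex serves as root directly. If [z] is interior to the edge from [a] to [b], the tree is
    first rooted at [a], which makes [a] the parent of [b] and a free index, and then rerooted. *)
Lemma rooted_tree_point (z : T) :
  exists (D : {set 'I_n}) (dep : 'I_n -> nat) (sg : 'I_n -> R -> T)
    (ct : 'I_n -> T -> R), rooted_tree z D dep sg ct.
Proof.
case: (carrier_cases sK oK (phi_carrier z)) => [[r rK zE]|[a [b [t [ab t01 zE]]]]].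
  have [par [D [dep [ct [rt _ _]]]]] := rooted_tree_vertex rK.
  by rewrite -(phiK z) zE; exists D, dep; eexists; exists ct; exact: rt.
have [par [D [dep [ct [rt aD tree]]]]] := rooted_tree_vertex (adj_vertex sK ab).
case: (tree a b ab) => -[bD bE]; last by rewrite bD in aD.
have -> : z = (fun v => psi \o (bary (par v) v \o clamp 1)) b t.
  by rewrite /= bE clamp_id -?zE ?phiK //; lra.
apply: (rooted_tree_reroot rt aD bD _ t01).
by rewrite /= bE clamp_id ?bary0 // lexx ler01.
Qed.

End Graph.

Theorem theorem4p2 (R : realType) (T : metricType R) (f : T -> T)
    (A : set T) (z : T) (p : nat) :
  topological_tree T ->
  continuous f ->
  hyperspace A ->
  periodic_point (induced_map f) A ->
  A z ->
  f z = z ->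
  is_period (induced_map f) A p ->
  (p %| \big[lcmn/1]_(1 <= k < (#|` fset_set (End (T := T))|).+1) k)%N.
Proof.
move=> [[[_ cT kT] [n [K [sK oK homeo]]]] noC] fc [_ cA kA] _ Az fz pA.
case: homeo => phi [psi [[phi_c psi_c] phiX _ phiK psiK]].
have phi_c' : continuous phi by exact/continuous_subspace_setT.
have phi_carrier x : carrier K (phi x) by apply: phiX; exists x.
have phiK' : cancel phi psi by move=> x; apply: phiK; rewrite inE.
have psiK' x : carrier K x -> phi (psi x) = x by move=> cx; apply: psiK; rewrite inE.
have [D [dep [sg [ct rt]]]] := rooted_tree_point sK oK phi_c' psi_c phi_carrier
  phiK' psiK' kT noC z.
(* There are at most as many leaves as endpoints, so the lcm for the leaves divides the one for the
   endpoints. *)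
apply: dvdn_trans (biglcm_nat_dvdn (card_leaves rt)).
have clA : closed A by apply: compact_closed => //; exact: metric_hausdorff.
exact: (rooted_tree_period rt cT fc fz clA kA Az pA).
Qed.
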